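(* Let $G$ be a finite solvable group with Fitting subgroup $F=F(G)$, let $\pi^*=\pi(G:F)$ be the set of primes dividing $|G:F|$, and let $Q$ be a Hall $\pi^*$-subgroup of $G$. (1) Suppose that $A$ is a core-free mt-stabilizer in $G$ with $A\subseteq F$. Let $P$ be a normal Sylow $p$-subgroup of $G$, and put $A_P:=A\cap P$ and $A_Q:=A\cap Q$. Then $p\notin\pi^*$. Furthermore, for every conjugate $Q^*$ of $Q$, $A_Q\times A_P$ is core-free in $Q^*P$ and $A_Q\times A_P$ is an mt-stabilizer in $Q^*P$. (2) Conversely, let $P_1,P_2,\dots,P_t$ ($t\geq 1$) be the normal Sylow subgroups of $G$, where $P_i$ is a Sylow $p_i$-subgroup and $p_1,\dots,p_t$ are the distinct prime divisors of $|G|$ for which the Sylow subgroup is normal. Suppose there exist a subgroup $A_Q$ of $F\cap Q$ and subgroups $A_{P_i}\subseteq P_i$ such that, for all conjugates $Q^*$ of $Q$ and all $i=1,\dots,t$, $A_Q\times A_{P_i}$ is a core-free mt-stabilizer in $Q^*P_i$. Then $A_Q\times A_{P_1}\times\cdots\times A_{P_t}$ is an mt-stabilizer in $G$ and is core-free in $G$.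
   Context: All groups are finite. For a subgroup $A$ of $G$, $G:A$ denotes the set of cosets of $A$ in $G$ with the natural transitive action of $G$; its kernel is the core $K_{G:A}=\bigcap_{g\in G}A^g$. $A$ is core-free in $G$ if $K_{G:A}=1$. The subgroup $A$ is an mt-stabilizer in $G$ (equivalently, $G$ acts minimally transitively on $G:A$) if every subgroup $H$ with $K_{G:A}\subseteq H\subsetneq G$ acts intransitively on $G:A$; that is, whenever a subgroup $H\subseteq G$ is transitive on $G:A$, then $HK_{G:A}=G$. The Fitting subgroup $F(G)$ is the largest nilpotent normal subgroup of $G$. Products such as $A_Q\times A_P$ denote internal direct products of subgroups of $F$ (the factors have coprime orders and lie in the nilpotent group $F$). *)

(* Defs.v *)
From mathcomp Require Import all_boot all_fingroup all_solvable.

Set Implicit Arguments.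
Unset Strict Implicit.
Unset Printing Implicit Defensive.

Local Open Scope group_scope.

(* [gcore A G] unfolds to the intersection of the [A :^ x] for [x] in [G],
   i.e. the kernel of the action of [G] on the cosets of [A]. *)
Definition core_free (gT : finGroupType) (G A : {group gT}) : Prop :=
  gcore A G = 1.

(* The coset space is [rcosets A G], acted on by right translation. *)
Definition mt_stabilizer (gT : finGroupType) (G A : {group gT}) : Prop :=
  A \subset G /\
  forall H : {group gT}, gcore A G \subset H -> H \proper G ->
    ~~ [transitive H, on rcosets A G | 'Rs].

(* MathComp's [\x] and [\big[dprod/1]] denote a group only when the product is
   direct (they give [set0] otherwise), hence the predicate on sets: [S] is a
   subgroup which is a core-free mt-stabilizer in [G]. *)
Definition core_free_mt_stabilizer (gT : finGroupType) (G : {group gT})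
    (S : {set gT}) : Prop :=
  exists2 B : {group gT}, S = B & core_free G B /\ mt_stabilizer G B.

(* Main.v *)
Require Import Defs.
From mathcomp Require Import all_boot all_fingroup all_solvable.

(** Write [pi] for the primes dividing [#|G : 'F(G)|].  A normal Sylow
    subgroup lies in [F := 'F(G)], so its prime is outside [pi]; conversely, for
    [q] outside [pi] the Sylow [q]-subgroup of the nilpotent group [F] is already
    one of [G], and it is normal.  Fix such a prime [p], with normal Sylow
    subgroup [P], put [rho := pi U {p}], and let [M] be the [rho']-part of [F].
    Then [T := Q^x P] is a Hall [rho]-subgroup of [G], [M] is a normal Hall
    [rho']-subgroup, so [G = M ><| T] ([sdprod_pcore_Fitting]), and [M]
    centralises every [rho]-subgroup of [F] ([cent_pcore_Fitting]).

    In terms of factorisations, a core-free [A] is an mt-stabilizer exactly when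
    [A * H = G] forces [H = G] ([core_free_mt_stabilizerP]).

    Going down from [G] to [T], let [B] be the part of [A] in [T].  A subgroup
    of [B] normalised by [T] is centralised by [M], hence normal in [G], hence
    trivial; and a factorisation [B * H = T] gives [A * (M * H) = G], whence
    [M * H = G] and [H = T] ([core_free_mt_stabilizer_sdprod]).

    Going up, let [A] be the product of the given pieces.  The core of [A] in [G]
    meets each [Q P_i] trivially ([core_meet_trivial]), so it meets a Hall
    [pi]-subgroup and all Sylow subgroups for the other primes trivially, which
    leaves no prime to divide its order.  If [A * H = G], choose [x] such
    that [Q^x] contains a Hall [pi]-subgroup of [H]; it is for this that all
    conjugates of [Q] are needed.  For every [i], [H] then meets [T := Q^x P_i]
    in a Hall subgroup of [H], so that [A * H = G] projects modulo [M] to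
    [B * (H :&: T) = T] and hence [T] lies in [H]
    ([core_free_mt_stabilizer_Hall_sub]).  So [H] contains a Hall [pi]-subgroup
    and all remaining Sylow subgroups of [G], that is, [H = G]. *)

Set Implicit Arguments.
Unset Strict Implicit.
Unset Printing Implicit Defensive.

Local Open Scope group_scope.

(** * Minimal transitivity as a factorisation property *)

Section Factorisations.

Variable gT : finGroupType.
Implicit Types (pi : nat_pred) (A B G H K M P Q T : {group gT}).

Lemma transitive_rcosetsE G A H :
  A \subset G -> H \subset G ->
  [transitive H, on rcosets A G | 'Rs] = (A * H == G).
Proof.
move=> sAG sHG; have SA : (A : {set gT}) \in rcosets A G.
  by rewrite -{1}(mulg1 A) -rcosetE imset_f.
rewrite (sameP (subgroup_transitiveP SA sHG (transRs_rcosets A G)) eqP).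
by rewrite astab1Rs (setIidPr sAG).
Qed.

(** As the core is trivial, the condition that [H] contain it disappears. *)
Lemma core_free_mt_stabilizerP G A :
  core_free G A ->
  mt_stabilizer G A <->
  A \subset G /\ forall H, H \subset G -> A * H = G -> H :=: G.
Proof.
move=> cfA; split=> -[sAG mtA]; split=> // H.
  move=> sHG defG; apply/eqP; rewrite eqEproper sHG /=; apply/negP=> prH.
  have coreH : gcore A G \subset H by rewrite cfA sub1G.
  by have := mtA H coreH prH; rewrite transitive_rcosetsE // defG eqxx.
move=> _ prH; have sHG := proper_sub prH.
rewrite transitive_rcosetsE //; apply/eqP=> /(mtA H sHG) defH.
by rewrite defH properxx in prH.
Qed.

(** * Passing between a group and a complement of a normal subgroup *)

(** The centralising hypothesis makes a subgroup of [B] normalised by [T] normal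
    in [G], and lets [M] move past [B], turning [B * H = T] into the
    factorisation [B * (M * H) = G]. *)
Lemma core_free_mt_stabilizer_sdprod G M T A B :
  M ><| T = G -> core_free G A -> mt_stabilizer G A ->
  B \subset A -> B \subset T -> M \subset 'C(B) ->
  core_free T B /\ mt_stabilizer T B.
Proof.
move=> defG cfA mtA sBA sBT cMB.
have [_ defMT nMT tiMT] := sdprodP defG.
have [sAG mtA'] := (core_free_mt_stabilizerP cfA).1 mtA.
have sMG : M \subset G by rewrite -defMT mulG_subl.
have sTG : T \subset G by rewrite -defMT mulG_subr.
have cfB : core_free T B.
  apply/trivgP; rewrite -cfA gcore_max ?(subset_trans (gcore_sub _ _)) //.
  rewrite -defMT mul_subG ?gcore_norm // cents_norm //.
  exact: subset_trans cMB (centS (gcore_sub _ _)).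
split=> //; apply/(core_free_mt_stabilizerP cfB); split=> // H sHT defT.
have defMH : M * H = G.
  rewrite -norm_joinEr ?(subset_trans sHT) //; apply: mtA'.
    by rewrite join_subG sMG (subset_trans sHT).
  apply/eqP; rewrite eqEsubset mul_subG //=; last first.
    by rewrite join_subG sMG (subset_trans sHT).
  rewrite norm_joinEr ?(subset_trans sHT) //.
  by rewrite -defMT -defT mulgA (centC cMB) -mulgA mulSg.
apply/eqP; rewrite eqEsubset sHT /=.
have: T \subset T :&: (M * H) by rewrite subsetI subxx defMH.
by rewrite -group_modr // setIC tiMT mul1g.
Qed.

(** The factorisation [A * H = G] is projected from [G] onto [T] along [M].  The
    Hall condition on [H :&: T] ensures that [H] splits along
    [G = M ><| T], so that the projection of [H] is [H :&: T] itself. *)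
Lemma core_free_mt_stabilizer_Hall_sub pi G M T A B H :
  M ><| T = G -> pi.-Hall(G) T -> A \subset M * B -> B \subset T ->
  core_free T B -> mt_stabilizer T B ->
  H \subset G -> A * H = G -> pi.-Hall(H) (H :&: T) -> T \subset H.
Proof.
move=> defG hallT sAMB sBT cfB mtB sHG defAH hallHT.
have [nsMG _ _ _ _] := sdprod_context defG.
have [_ defMT nMT tiMT] := sdprodP defG.
have hallM : pi^'.-Hall(G) M by apply/(sdprod_normal_pHallP nsMG hallT).
have defH : (M :&: H) * (H :&: T) = H.
  have nsMH : M :&: H <| H.
    rewrite /normal subsetIr normsI ?normG //.
    exact: subset_trans (normal_norm nsMG).
  have hallMH := setI_normal_Hall nsMG hallM sHG.
  by have /sdprodP[] := elimT (sdprod_normal_pHallP nsMH hallHT) hallMH.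
have sTG : T \subset G by rewrite -defMT mulG_subr.
have sTB : T \subset B * (H :&: T).
  have sBHT : B * (H :&: T) \subset T by rewrite mul_subG ?subsetIr.
  have nMB := subset_trans sBT nMT.
  have: T \subset T :&: (M * (B * (H :&: T))).
    rewrite subsetI subxx (subset_trans sTG) //.
    have <-: M * B * (M * (H :&: T)) = M * (B * (H :&: T)).
      by rewrite -!mulgA [B * (M * _)]mulgA (normC nMB) !mulgA mulGid.
    by rewrite -{1}defAH mulgSS // -{1}defH mulSg ?subsetIl.
  by rewrite -group_modr // setIC tiMT mul1g.
have [_ mtB'] := (core_free_mt_stabilizerP cfB).1 mtB.
rewrite -{1}(mtB' (H :&: T)%G) ?subsetIl ?subsetIr //.
by apply/eqP; rewrite eqEsubset sTB mul_subG ?subsetIr.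
Qed.

(** By Dedekind, [A :&: T \subset B]; and the core of [A] in [G] is normalised
    by [T]. *)
Lemma core_meet_trivial G M T A B :
  M ><| T = G -> A \subset M * B -> B \subset T -> core_free T B ->
  gcore A G :&: T = 1.
Proof.
move=> defG sAMB sBT cfB; have [_ defMT _ tiMT] := sdprodP defG.
have sTG : T \subset G by rewrite -defMT mulG_subr.
apply/trivgP; rewrite -cfB gcore_max //; last first.
  by rewrite normsI ?normG // (subset_trans sTG) ?gcore_norm.
apply: subset_trans (setSI T (subset_trans (gcore_sub A G) sAMB)) _.
by rewrite setIC -group_modr // setIC tiMT mul1g.
Qed.

End Factorisations.

(** * Hall subgroups built from the Fitting subgroup *)

Section HallSubgroups.

Variable gT : finGroupType.
Implicit Types (pi rho tau : nat_pred) (A G H K P Q R T : {group gT}).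

Lemma normal_TI_Hall pi G K Q :
  K <| G -> pi.-Hall(G) Q -> Q :&: K = 1 -> pi^'.-group K.
Proof.
move=> nsKG hallQ tiQK; rewrite -(partG_eq1 pi K).
by rewrite -(card_Hall (Hall_setI_normal nsKG hallQ)) /= tiQK cards1.
Qed.

(** The index of [T] divides both a [pi1']-number and a [pi2']-number. *)
Lemma pHall_predU pi1 pi2 G T Q P :
  pi1.-Hall(G) Q -> pi2.-Hall(G) P -> Q \subset T -> P \subset T ->
  T \subset G -> [predU pi1 & pi2].-group T -> [predU pi1 & pi2].-Hall(G) T.
Proof.
move=> /and3P[_ _ iQ] /and3P[_ _ iP] sQT sPT sTG rT.
have iTQ := pnat_dvd (indexgS G sQT) iQ.
have iTP := pnat_dvd (indexgS G sPT) iP.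
rewrite /pHall sTG rT; apply/pnatP=> // q pr_q q_dv; rewrite !inE negb_or.
by rewrite [q \notin _](pnatP _ _ iTQ) // [q \notin _](pnatP _ _ iTP).
Qed.

Lemma pHall_predU_joing pi1 pi2 G Q P :
  pi1.-Hall(G) Q -> pi2.-Hall(G) P -> P <| G ->
  [predU pi1 & pi2].-Hall(G) (Q <*> P).
Proof.
move=> hallQ hallP nsPG.
have [[sQG piQ _] [sPG piP _]] := (and3P hallQ, and3P hallP).
apply: (pHall_predU hallQ hallP); rewrite ?joing_subl ?joing_subr //=.
  by rewrite join_subG sQG.
have nPQ := subset_trans sQG (normal_norm nsPG).
rewrite /= norm_joinEl // pgroupM; apply/andP; split.
  by apply: sub_pgroup piQ => q; rewrite !inE => ->.
by apply: sub_pgroup piP => q; rewrite !inE => ->; rewrite orbT.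
Qed.

Lemma normal_Sylow_notin_pi_Fitting G P p :
  p.-Sylow(G) P -> P <| G -> p \notin \pi(#|G : 'F(G)|).
Proof.
move=> /and3P[_ pP iP] nsPG; rewrite -p'natEpi ?indexg_gt0 //.
by apply: pnat_dvd (indexgS _ _) iP; rewrite Fitting_max ?(pgroup_nil pP).
Qed.

Lemma pHall_pcore_Fitting tau G :
  {subset tau <= \pi(#|G : 'F(G)|)^'} -> tau.-Hall(G) 'O_tau('F(G)).
Proof.
move=> tau_pi'; have sFG := Fitting_sub G.
have /and3P[sOF tauO iO] := nilpotent_pcore_Hall tau (Fitting_nil G).
rewrite /pHall tauO (subset_trans sOF sFG) -(Lagrange_index sFG sOF).
rewrite pnatM iO andbT.
apply: sub_in_pnat (pnat_pi (indexg_gt0 _ _)) => q _ pi_q.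
by apply: contraL pi_q => /tau_pi'.
Qed.

Lemma sdprod_pcore_Fitting rho G T :
  {subset \pi(#|G : 'F(G)|) <= rho} -> rho.-Hall(G) T ->
  'O_rho^'('F(G)) ><| T = G.
Proof.
move=> pi_rho hallT.
have nsMG : 'O_rho^'('F(G)) <| G.
  exact: char_normal_trans (pcore_char _ _) (Fitting_normal G).
apply/(sdprod_normal_pHallP nsMG hallT)/pHall_pcore_Fitting => q.
by apply: contra => /pi_rho.
Qed.

Lemma pgroup_sub_pcore_Fitting pi G A :
  A \subset 'F(G) -> pi.-group A -> A \subset 'O_pi('F(G)).
Proof.
have hallO := nilpotent_pcore_Hall pi (Fitting_nil G).
by move=> sAF piA; rewrite (sub_normal_Hall hallO) ?pcore_normal.
Qed.

Lemma cent_pcore_Fitting rho G A :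
  A \subset 'F(G) -> rho.-group A -> 'O_rho^'('F(G)) \subset 'C(A).
Proof.
move=> sAF rhoA.
have [_ _ cOO _] := dprodP (nilpotent_pcoreC rho (Fitting_nil G)).
exact: subset_trans cOO (centS (pgroup_sub_pcore_Fitting sAF rhoA)).
Qed.

(** The [pi]-part of [F] is normal in [G], so it lies in every Hall
    [pi]-subgroup of [G]. *)
Lemma Fitting_setI_sub_Hall pi G Q R :
  pi.-Hall(G) Q -> pi.-Hall(G) R -> 'F(G) :&: Q \subset R.
Proof.
move=> hallQ hallR; apply: subset_trans (pcore_sub_Hall hallR).
apply: (@subset_trans _ _ 'O_pi('F(G))).
  rewrite (@pgroup_sub_pcore_Fitting _ _ ('F(G) :&: Q)) ?subsetIl //.
  exact: pgroupS (subsetIr _ _) (pHall_pgroup hallQ).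
rewrite pcore_max ?pcore_pgroup //.
exact: char_normal_trans (pcore_char _ _) (Fitting_normal G).
Qed.

(** A normal subgroup of [G] is recognised as trivial, and a subgroup as the
    whole of [G], one prime at a time: a Hall [pi]-subgroup and the subgroups
    [P i] together account for every prime dividing [#|G|]. *)
Section AllPrimes.

Variables (I : Type) (pi : nat_pred) (p : I -> nat) (G Q : {group gT}).
Variable P : I -> {group gT}.
Hypothesis hallQ : pi.-Hall(G) Q.
Hypothesis sylP : forall i, (p i).-Sylow(G) (P i).
Hypothesis all_primes :
  forall q, prime q -> q %| #|G| -> q \in pi \/ exists i, p i = q.

Lemma normal_TI_all_Hall K :
  K <| G -> Q :&: K = 1 -> (forall i, P i :&: K = 1) -> K :=: 1.
Proof.
move=> nsKG tiQK tiPK; have pi'K := normal_TI_Hall nsKG hallQ tiQK.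
apply/eqP; rewrite trivg_card1 eqn_leq cardG_gt0 andbT leqNgt.
apply/negP=> /pdivP[q pr_q q_dv].
have q_dvG := dvdn_trans q_dv (cardSg (normal_sub nsKG)).
have [pi_q | [i def_q]] := all_primes pr_q q_dvG.
  by have := pgroupP pi'K q pr_q q_dv; rewrite inE /= pi_q.
have p'K := normal_TI_Hall nsKG (sylP i) (tiPK i).
by have := pgroupP p'K q pr_q q_dv; rewrite !inE def_q eqxx.
Qed.

Lemma sub_all_Hall_eq H :
  H \subset G -> Q \subset H -> (forall i, P i \subset H) -> H :=: G.
Proof.
move=> sHG sQH sPH; apply/eqP; rewrite eqEsubset sHG -indexg_eq1 /=.
apply/contraT=> ne1; have /pdivP[q pr_q q_dv] : 1 < #|G : H|.
  by rewrite ltn_neqAle eq_sym ne1 indexg_gt0.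
have Hall_index (tau : nat_pred) (R : {group gT}) :
    tau.-Hall(G) R -> R \subset H -> q \in tau^'.
  case/and3P=> _ _ iR sRH.
  exact: (pnatP _ (indexg_gt0 _ _) (pnat_dvd (indexgS G sRH) iR)).
have q_dvG := dvdn_trans q_dv (dvdn_indexg G H).
have [pi_q | [i def_q]] := all_primes pr_q q_dvG.
  by have := Hall_index _ _ hallQ sQH; rewrite inE /= pi_q.
by have := Hall_index _ _ (sylP i) (sPH i); rewrite !inE def_q eqxx.
Qed.

End AllPrimes.

End HallSubgroups.

(** * The two directions *)

Section LocalGlobal.

Variables (gT : finGroupType) (G Q : {group gT}).
Local Notation pi := \pi(#|G : 'F(G)|).
Local Notation rho p := ([predU pi & (p%N : nat_pred)] : nat_pred).
Hypothesis hallQ : pi.-Hall(G) Q.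

Lemma pHall_conj_joing_Sylow p (P : {group gT}) x :
  p.-Sylow(G) P -> P <| G -> x \in G -> (rho p).-Hall(G) (Q :^ x <*> P).
Proof.
by move=> sylP nsPG Gx; apply: pHall_predU_joing => //; rewrite pHallJ.
Qed.

Lemma sdprod_conj_joing_Sylow p (P : {group gT}) x :
    p.-Sylow(G) P -> P <| G -> x \in G ->
  'O_(rho p)^'('F(G)) ><| (Q :^ x <*> P) = G.
Proof.
move=> sylP nsPG Gx.
apply: (sdprod_pcore_Fitting _ (pHall_conj_joing_Sylow sylP nsPG Gx)) => q.
by rewrite !inE => ->.
Qed.

Lemma core_free_mt_stabilizer_local (A P : {group gT}) (p : nat) (x : gT) :
    core_free G A -> mt_stabilizer G A -> A \subset 'F(G) ->
    p.-Sylow(G) P -> P <| G -> x \in G ->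
  core_free_mt_stabilizer (Q :^ x <*> P)%G ((A :&: Q) \x (A :&: P)).
Proof.
move=> cfA mtA sAF sylP nsPG Gx.
have piAQ := pgroupS (subsetIr A Q) (pHall_pgroup hallQ).
have pi'AP : pi^'.-group (A :&: P).
  apply: pi_pgroup (pgroupS (subsetIr A P) (pHall_pgroup sylP)) _.
  exact: normal_Sylow_notin_pi_Fitting sylP nsPG.
exists ((A :&: Q) <*> (A :&: P))%G.
  apply: dprodEY; last exact: coprime_TIg (pnat_coprime piAQ pi'AP).
  have sAQF := subset_trans (subsetIl A Q) sAF.
  have sAPF := subset_trans (subsetIl A P) sAF.
  apply: subset_trans (cent_pcore_Fitting sAQF piAQ).
  exact: (pgroup_sub_pcore_Fitting sAPF pi'AP).
have sBA : (A :&: Q) <*> (A :&: P) \subset A by rewrite join_subG !subsetIl.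
have sBT : (A :&: Q) <*> (A :&: P) \subset Q :^ x <*> P.
  rewrite genS // setUSS ?subsetIr // (subset_trans (setSI _ sAF)) //.
  by rewrite (Fitting_setI_sub_Hall hallQ) ?pHallJ.
have defG := sdprod_conj_joing_Sylow sylP nsPG Gx.
apply: (core_free_mt_stabilizer_sdprod defG cfA mtA sBA sBT).
apply: cent_pcore_Fitting (subset_trans sBA sAF) _.
exact: pgroupS sBT (pHall_pgroup (pHall_conj_joing_Sylow sylP nsPG Gx)).
Qed.

Lemma core_free_mt_stabilizer_global (t : nat) (p : 'I_t -> nat)
    (P : 'I_t -> {group gT}) (AQ : {group gT}) (AP : 'I_t -> {group gT}) :
    solvable G -> 0 < t -> injective p ->
    (forall i, (p i).-Sylow(G) (P i)) -> (forall i, P i <| G) ->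
    (forall (q : nat) (R : {group gT}),
      prime q -> q %| #|G| -> q.-Sylow(G) R -> R <| G -> exists i, p i = q) ->
    AQ \subset 'F(G) :&: Q -> (forall i, AP i \subset P i) ->
    (forall (x : gT) (i : 'I_t), x \in G ->
      core_free_mt_stabilizer (Q :^ x <*> P i)%G (AQ \x AP i)) ->
  core_free_mt_stabilizer G (AQ \x \big[dprod/1]_(i < t) AP i).
Proof.
move=> solG t_gt0 inj_p sylP nsPG allP sAQ sAP cfmt.
have pi'p i : p i \in pi^' := normal_Sylow_notin_pi_Fitting (sylP i) (nsPG i).
have all_primes q : prime q -> q %| #|G| -> q \in pi \/ exists i, p i = q.
  move=> pr_q q_dv; case: (boolP (q \in pi)) => [|pi'q]; [by left | right].
  apply: (allP q 'O_q('F(G))%G) => //.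
    by apply: pHall_pcore_Fitting => r /eqP->.
  exact: char_normal_trans (pcore_char _ _) (Fitting_normal G).
have piAQ : pi.-group AQ.
  exact: pgroupS (subset_trans sAQ (subsetIr _ _)) (pHall_pgroup hallQ).
have sAQF : AQ \subset 'F(G) := subset_trans sAQ (subsetIl _ _).
have pAP i : (p i).-group (AP i) := pgroupS (sAP i) (pHall_pgroup (sylP i)).
have sAPF i : AP i \subset 'F(G).
  apply: subset_trans (sAP i) (Fitting_max (nsPG i) _).
  exact: pgroup_nil (pHall_pgroup (sylP i)).
have p'AP i j : i != j -> (p j)^'.-group (AP i).
  by move=> ne_ij; apply: pi_pgroup (pAP i) _; rewrite !inE (inj_eq inj_p).
have cAP i j : i != j -> AP i \subset 'C(AP j).
  move=> ne_ij; apply: subset_trans (cent_pcore_Fitting (sAPF j) (pAP j)).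
  exact: pgroup_sub_pcore_Fitting (sAPF i) (p'AP _ _ ne_ij).
set C := (\prod_(i < t) AP i)%G.
have sC : C \subset 'O_pi^'('F(G)).
  rewrite /C bigprodGE gen_subG; apply/bigcupsP=> i _.
  exact: pgroup_sub_pcore_Fitting (sAPF i) (pi_pgroup (pAP i) (pi'p i)).
have defC : \big[dprod/1]_(i < t) AP i = C.
  apply: bigcprod_coprime_dprod => [|i j _ _ ne_ij].
    by apply/eqP/bigcprodYP => i j _ _; apply: cAP.
  by apply: pnat_coprime (pAP i) (p'AP _ _ _); rewrite eq_sym.
exists (AQ <*> C)%G.
  rewrite defC; apply: dprodEY.
    exact: subset_trans sC (cent_pcore_Fitting sAQF piAQ).
  by apply: coprime_TIg; apply: pnat_coprime piAQ (pgroupS sC (pcore_pgroup _ _)).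
have sAG : AQ <*> C \subset G.
  apply: subset_trans (Fitting_sub G).
  by rewrite join_subG sAQF (subset_trans sC) ?pcore_sub.
have hallT x i Gx := @pHall_conj_joing_Sylow _ _ x (sylP i) (nsPG i) Gx.
have defG x i Gx := @sdprod_conj_joing_Sylow _ _ x (sylP i) (nsPG i) Gx.
(* [AP j] for [j != i] is absorbed by [M]; the other two factors make up [B]. *)
have local x i : x \in G -> exists2 B : {group gT},
    B \subset Q :^ x <*> P i /\ AQ <*> C \subset 'O_(rho (p i))^'('F(G)) * B
  & core_free (Q :^ x <*> P i)%G B /\ mt_stabilizer (Q :^ x <*> P i)%G B.
  move=> Gx; have [B defB [cfB mtB]] := cfmt x i Gx; exists B => //.
  have sBT : B \subset Q :^ x <*> P i by case: mtB.
  have [sQB sPB] : AQ \subset B /\ AP i \subset B.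
    by have [_ <- _ _] := dprodP defB; rewrite mulG_subl mulG_subr.
  have [_ _ nMT _] := sdprodP (defG x i Gx).
  split=> //; rewrite -norm_joinEr ?(subset_trans sBT) //.
  rewrite join_subG (subset_trans sQB) ?joing_subr //=.
  rewrite /C bigprodGE gen_subG; apply/bigcupsP=> j _.
  have [->|ne_ji] := eqVneq j i; first by rewrite (subset_trans sPB) ?joing_subr.
  apply: subset_trans (joing_subl _ _).
  apply: pgroup_sub_pcore_Fitting (sAPF j) (pi_pgroup (pAP j) _).
  by rewrite !inE (inj_eq inj_p) negb_or ne_ji andbT; apply: pi'p.
have i0 : 'I_t := Ordinal t_gt0.
have cfA : core_free G (AQ <*> C)%G.
  pose K := [group of gcore (AQ <*> C) G].
  have nsKG : K <| G := gcore_normal sAG.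
  have tiK i : K :&: (Q <*> P i) = 1.
    have [B [sBT sAMB] [cfB _]] := local 1 i (group1 G).
    have := core_meet_trivial (defG 1 i (group1 G)) sAMB sBT cfB.
    by rewrite /= conjsg1.
  apply: (normal_TI_all_Hall hallQ sylP all_primes nsKG) => [|i]; apply/trivgP.
    by rewrite -(tiK i0) subsetI subsetIr subIset ?joing_subl.
  by rewrite -(tiK i) subsetI subsetIr subIset ?joing_subr.
split=> //; apply/(core_free_mt_stabilizerP cfA); split=> // H sHG defAH.
have [Q0 hallQ0] := Hall_exists pi (solvableS sHG solG).
have [sQ0H piQ0 _] := and3P hallQ0.
have [y Gy sQ0Q] := Hall_Jsub solG hallQ (subset_trans sQ0H sHG) piQ0.
have [x Gx sQx] : exists2 x, x \in G & Q0 \subset Q :^ x.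
  by exists y^-1; rewrite ?groupV // -sub_conjg.
have sTH i : Q :^ x <*> P i \subset H.
  have [B [sBT sAMB] [cfB mtB]] := local x i Gx.
  have sylHP := setI_normal_Hall (nsPG i) (sylP i) sHG.
  apply: core_free_mt_stabilizer_Hall_sub (defG x i Gx) (hallT x i Gx)
    sAMB sBT cfB mtB sHG defAH _.
  apply: (pHall_predU hallQ0 sylHP).
  - by rewrite subsetI sQ0H (subset_trans sQx) ?joing_subl.
  - by rewrite subsetI subsetIr subIset ?joing_subr.
  - exact: subsetIl.
  exact: pgroupS (subsetIr _ _) (pHall_pgroup (hallT x i Gx)).
have hallQx : pi.-Hall(G) (Q :^ x) by rewrite pHallJ.
apply: (sub_all_Hall_eq hallQx sylP all_primes sHG) => [|i].
  exact: subset_trans (joing_subl _ _) (sTH i0).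
exact: subset_trans (joing_subr _ _) (sTH i).
Qed.

End LocalGlobal.

Theorem theorem3p2 (gT : finGroupType) (G Q : {group gT})
    (solG : solvable G) (hallQ : \pi(#|G : 'F(G)|).-Hall(G) Q) :
  (forall (A P : {group gT}) (p : nat),
      core_free G A -> mt_stabilizer G A -> A \subset 'F(G) ->
      prime p -> p.-Sylow(G) P -> P <| G ->
      p \notin \pi(#|G : 'F(G)|) /\
      (forall x : gT, x \in G ->
         core_free_mt_stabilizer (Q :^ x <*> P)%G
           ((A :&: Q) \x (A :&: P))))
  /\
  (forall (t : nat) (p : 'I_t -> nat) (P : 'I_t -> {group gT})
          (AQ : {group gT}) (AP : 'I_t -> {group gT}),
      0 < t ->
      injective p ->
      (forall i, [/\ prime (p i), p i %| #|G|, (p i).-Sylow(G) (P i)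
                   & P i <| G]) ->
      (forall (q : nat) (R : {group gT}),
         prime q -> q %| #|G| -> q.-Sylow(G) R -> R <| G ->
         exists i, p i = q) ->
      AQ \subset 'F(G) :&: Q ->
      (forall i, AP i \subset P i) ->
      (forall (x : gT) (i : 'I_t), x \in G ->
         core_free_mt_stabilizer (Q :^ x <*> P i)%G (AQ \x AP i)) ->
      core_free_mt_stabilizer G (AQ \x \big[dprod/1]_(i < t) AP i)).
Proof.
split=> [A P p cfA mtA sAF _ sylP nsPG | t p P AQ AP t_gt0 inj_p sylP].
  split=> [|x Gx]; first exact: normal_Sylow_notin_pi_Fitting sylP nsPG.
  exact: (core_free_mt_stabilizer_local hallQ cfA mtA sAF sylP nsPG Gx).
by apply: core_free_mt_stabilizer_global => // i; case: (sylP i).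
Qed.
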